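(* The series $\mathcal{VO}(z,q)$ and $\mathcal{XO}(z,q)$ belong to $\mathscr{U}_{z,q}^2$. In particular, $VO(m,n)\ge VO(m+2,n)$ and $XO(m,n)\ge XO(m+2,n)$ for all integers $m,n\ge0$.
   Context: $(a;q)_n=\prod_{0\le j<n}(1-aq^j)$ for $n\in\mathbb{N}_0\cup\{\infty\}$, $(a,b;q)_n=(a;q)_n(b;q)_n$. Define $$\mathcal{VO}(z,q)=\sum_{n\ge0}\sum_mVO(m,n)z^mq^n=\sum_{n\ge1}\frac{q^{2n-1}}{(zq^{2n+1},z^{-1}q^{2n+1};q^2)_\infty},\quad \mathcal{XO}(z,q)=\sum_{n\ge0}\sum_mXO(m,n)z^mq^n=\sum_{n\ge0}\frac{q^{2n+1}}{(zq,z^{-1}q;q^2)_n}$$ (rank generating functions of odd concave and odd convex compositions). $\mathscr{U}_z^2$ is the set of Laurent polynomials $\sum_ic_iz^i$ with real $c_i\ge0$, $c_{-i}=c_i$ and $c_{r+2\ell}\ge c_{r+2(\ell+1)}$ for $r\in\{0,1\}$, $\ell\ge0$; a series $\sum_nC_n(z)q^n$ lies in $\mathscr{U}_{z,q}^2$ if every $C_n(z)\in\mathscr{U}_z^2$. *)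

(* Defs.v *)
From HB Require Import structures.
From mathcomp Require Import all_boot all_order all_algebra.
From mathcomp Require Import finmap boolp classical_sets reals monalg.

Set Implicit Arguments.
Unset Strict Implicit.
Unset Printing Implicit Defensive.

Import Order.TTheory GRing.Theory Num.Theory.

Local Open Scope ring_scope.

(* R[z, z^-1] as finitely supported functions int -> R.  The ring structure
   of [malg] is not available here, because [monomType] excludes monoids with
   nontrivial units; only its module structure is inherited. *)
Definition laurent (R : nzRingType) := {malg R[int]}.

HB.instance Definition _ (R : nzRingType) := GRing.Lmodule.on (laurent R).

Definition zpow (R : nzRingType) (i : int) : laurent R := mkmalgU i 1.

Section LaurentRing.
Variable R : comNzRingType.
Implicit Types a b c : laurent R.

Definition lmul a b : laurent R :=
  \sum_(i <- msupp a) \sum_(j <- msupp b) mkmalgU (i + j) (a@_i * b@_j).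

Lemma lmulw (d1 d2 : {fset int}) a b :
  (msupp a `<=` d1)%fset -> (msupp b `<=` d2)%fset ->
  lmul a b = \sum_(i <- d1) \sum_(j <- d2) mkmalgU (i + j) (a@_i * b@_j).
Proof.
move=> le1 le2; rewrite /lmul (big_fset_incl _ le1) /=.
  apply: eq_bigr => i _; apply: big_fset_incl => // j _ /mcoeff_outdom ->.
  by rewrite mulr0 monalgU0.
move=> i _ /mcoeff_outdom ai.
by rewrite big1 // => j _; rewrite ai mul0r monalgU0.
Qed.

Lemma lmulC : commutative lmul.
Proof.
move=> a b; rewrite /lmul exchange_big /=.
by apply: eq_bigr => j _; apply: eq_bigr => i _; rewrite addrC mulrC.
Qed.

Lemma lmul0 : left_zero 0 lmul.
Proof. by move=> a; rewrite /lmul msupp0 big_seq_fset0. Qed.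

Lemma lmulDl : left_distributive lmul +%R.
Proof.
move=> a b c.
rewrite (lmulw (fsubsetUl (msupp a) (msupp b)) (fsubset_refl _)).
rewrite (lmulw (fsubsetUr (msupp a) (msupp b)) (fsubset_refl _)).
rewrite (lmulw (msuppD_le _ _) (fsubset_refl _)).
rewrite -big_split /=; apply: eq_bigr => i _.
rewrite -big_split /=; apply: eq_bigr => j _.
by rewrite mcoeffD mulrDl monalgUD.
Qed.

Lemma lmulUg (x : R) (i : int) b :
  lmul (mkmalgU i x) b = \sum_(j <- msupp b) mkmalgU (i + j) (x * b@_j).
Proof.
rewrite (lmulw msuppU_le (fsubset_refl _)) big_seq_fset1.
by apply: eq_bigr => j _; rewrite mcoeffUU.
Qed.

Lemma lmulUU (x y : R) (i j : int) :
  lmul (mkmalgU i x) (mkmalgU j y) = mkmalgU (i + j) (x * y).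
Proof. by rewrite (lmulw msuppU_le msuppU_le) !big_seq_fset1 !mcoeffUU. Qed.

Lemma lmulDr : right_distributive lmul +%R.
Proof. by move=> a b c; rewrite lmulC lmulDl !(lmulC _ a). Qed.

Lemma lmulr0 : right_zero 0 lmul.
Proof. by move=> a; rewrite lmulC lmul0. Qed.

Lemma lmulEl a b : lmul a b = \sum_(i <- msupp a) lmul (mkmalgU i a@_i) b.
Proof. by apply: eq_bigr => i _; rewrite lmulUg. Qed.

Lemma lmulEr a b : lmul a b = \sum_(j <- msupp b) lmul a (mkmalgU j b@_j).
Proof.
by rewrite lmulC lmulEl; apply: eq_bigr => j _; rewrite lmulC.
Qed.

Lemma lmulA : associative lmul.
Proof.
move=> a b c.
rewrite [RHS](big_morph (lmul^~ _) (fun _ _ => lmulDl _ _ _) (lmul0 _)).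
rewrite lmulEl; apply: eq_bigr => i _.
rewrite [LHS](big_morph (lmul _) (fun _ _ => lmulDr _ _ _) (lmulr0 _)).
rewrite [RHS](big_morph (lmul^~ _) (fun _ _ => lmulDl _ _ _) (lmul0 _)).
apply: eq_bigr => j _.
rewrite [LHS](big_morph (lmul _) (fun _ _ => lmulDr _ _ _) (lmulr0 _)).
by rewrite lmulEr; apply: eq_bigr => k _; rewrite !lmulUU addrA mulrA.
Qed.

Lemma lmul1 : left_id (zpow R 0) lmul.
Proof.
move=> a; rewrite /zpow lmulUg [RHS]monalgE.
by apply: eq_bigr => j _; rewrite add0r mul1r.
Qed.

Lemma laurent1_neq0 : zpow R 0 != 0 :> laurent R.
Proof. by rewrite monalgU_eq0 oner_eq0. Qed.

HB.instance Definition _ := GRing.Zmodule_isComNzRing.Build (laurent R)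
  lmulA lmulC lmul1 lmulDl laurent1_neq0.

Lemma zpow0 : zpow R 0 = 1.
Proof. by []. Qed.

Lemma zpowD (i j : int) : zpow R (i + j) = zpow R i * zpow R j.
Proof. by rewrite [RHS]lmulUU mulr1. Qed.

End LaurentRing.

(* A[[q]], a power series being the sequence of its coefficients. *)
Record fps (A : Type) := Fps { fcoef : nat -> A }.

Section FpsRing.
Variable A : comNzRingType.
Implicit Types f g h : fps A.

Lemma fpsP f g : fcoef f =1 fcoef g -> f = g.
Proof. by case: f g => [f] [g] /= /funext ->. Qed.

HB.instance Definition _ := gen_eqMixin (fps A).
HB.instance Definition _ := gen_choiceMixin (fps A).

Definition fps0 : fps A := Fps (fun=> 0).
Definition fps_opp f : fps A := Fps (fun n => - fcoef f n).
Definition fps_add f g : fps A := Fps (fun n => fcoef f n + fcoef g n).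

Lemma fps_addA : associative fps_add.
Proof. by move=> f g h; apply: fpsP => n /=; rewrite addrA. Qed.
Lemma fps_addC : commutative fps_add.
Proof. by move=> f g; apply: fpsP => n /=; rewrite addrC. Qed.
Lemma fps_add0 : left_id fps0 fps_add.
Proof. by move=> f; apply: fpsP => n /=; rewrite add0r. Qed.
Lemma fps_addN : left_inverse fps0 fps_opp fps_add.
Proof. by move=> f; apply: fpsP => n /=; rewrite addNr. Qed.

HB.instance Definition _ := GRing.isZmodule.Build (fps A)
  fps_addA fps_addC fps_add0 fps_addN.

Definition fpsC (c : A) : fps A := Fps (fun n => if n == 0%N then c else 0).
Definition fpsX : fps A := Fps (fun n => (n == 1%N)%:R).
Definition fps_mul f g : fps A :=
  Fps (fun n => \sum_(i < n.+1) fcoef f i * fcoef g (n - i)).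

Definition fps_trunc N f : {poly A} := \poly_(i < N.+1) fcoef f i.

Lemma coef_trunc N f n : (n <= N)%N -> (fps_trunc N f)`_n = fcoef f n.
Proof. by move=> nN; rewrite coef_poly ltnS nN. Qed.

Lemma coef_trunc_mul N f g n : (n <= N)%N ->
  fcoef (fps_mul f g) n = (fps_trunc N f * fps_trunc N g)`_n.
Proof.
move=> nN; rewrite coefM; apply: eq_bigr => i _.
rewrite !coef_trunc ?(leq_trans (leq_subr _ _)) //.
by rewrite (leq_trans _ nN) // -ltnS.
Qed.

Lemma fps_mulC : commutative fps_mul.
Proof.
by move=> f g; apply: fpsP => n; rewrite !(coef_trunc_mul _ _ (leqnn n)) mulrC.
Qed.

Lemma fps_mulA : associative fps_mul.
Proof.
move=> f g h; apply: fpsP => n; rewrite !(coef_trunc_mul _ _ (leqnn n)).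
transitivity (fps_trunc n f * (fps_trunc n g * fps_trunc n h))`_n.
  rewrite [LHS]coefM [RHS]coefM; apply: eq_bigr => i _; congr (_ * _).
  by rewrite coef_trunc ?leq_subr // (coef_trunc_mul (N := n)) ?leq_subr.
rewrite mulrA [LHS]coefM [RHS]coefM; apply: eq_bigr => i _; congr (_ * _).
have iN : (i <= n)%N by rewrite -ltnS.
by rewrite coef_trunc // (coef_trunc_mul _ _ iN).
Qed.

Lemma fps_mul1 : left_id (fpsC 1) fps_mul.
Proof.
move=> f; apply: fpsP => n /=; rewrite big_ord_recl /= subn0 mul1r.
by rewrite big1 ?addr0 // => i _; rewrite mul0r.
Qed.

Lemma fps_mulDl : left_distributive fps_mul +%R.
Proof.
move=> f g h; apply: fpsP => n /=; rewrite -big_split /=.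
by apply: eq_bigr => i _; rewrite mulrDl.
Qed.

Lemma fps1_neq0 : fpsC 1 != 0 :> fps A.
Proof.
by apply/eqP => /(congr1 (fun f => fcoef f 0)) /= /eqP; rewrite oner_eq0.
Qed.

HB.instance Definition _ := GRing.Zmodule_isComNzRing.Build (fps A)
  fps_mulA fps_mulC fps_mul1 fps_mulDl fps1_neq0.

Definition fps_unit : {pred fps A} := fun f => `[< exists g, g * f = 1 >].
Definition fps_inv f : fps A := xget f [set g | g * f = 1]%classic.

Lemma fps_mulVf : {in fps_unit, left_inverse 1 fps_inv *%R}.
Proof. by move=> f /asboolP ex; apply: (xgetPex f ex). Qed.

Lemma fps_unitP f g : g * f = 1 -> f \in fps_unit.
Proof. by move=> gf1; apply/asboolP; exists g. Qed.

Lemma fps_inv_out : {in [predC fps_unit], fps_inv =1 id}.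
Proof.
move=> f /negP nf; rewrite /fps_inv; case: xgetP => // g _ gf1.
by case: nf; apply: (fps_unitP gf1).
Qed.

HB.instance Definition _ := GRing.ComNzRing_hasMulInverse.Build (fps A)
  fps_mulVf fps_unitP fps_inv_out.

Lemma fcoefD f g n : fcoef (f + g) n = fcoef f n + fcoef g n.
Proof. by []. Qed.

Lemma fcoefN f n : fcoef (- f) n = - fcoef f n.
Proof. by []. Qed.

Lemma fcoef_sum (I : Type) (s : seq I) (P : pred I) (F : I -> fps A) n :
  fcoef (\sum_(i <- s | P i) F i) n = \sum_(i <- s | P i) fcoef (F i) n.
Proof. exact: (big_morph (fun f => fcoef f n)). Qed.

Lemma fcoef1 n : fcoef (1 : fps A) n = (n == 0%N)%:R.
Proof. by rewrite [LHS]/=; case: eqP. Qed.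

Lemma fcoefM f g n :
  fcoef (f * g) n = \sum_(i < n.+1) fcoef f i * fcoef g (n - i).
Proof. by []. Qed.

(* f is divisible by q^k *)
Definition fps_val_ge (k : nat) f := forall n, (n < k)%N -> fcoef f n = 0.

Lemma fps_val_geM j k f g :
  fps_val_ge j f -> fps_val_ge k g -> fps_val_ge (j + k) (f * g).
Proof.
move=> fj gk n ltn; rewrite fcoefM big1 // => i _.
have [/fj -> | ji] := ltnP i j; first by rewrite mul0r.
by rewrite gk ?mulr0 // ltn_subLR 1?(leq_trans ltn) ?leq_add2r // -ltnS.
Qed.

Lemma fps_val_geMl k f g : fps_val_ge k f -> fps_val_ge k (f * g).
Proof. by move=> fk; rewrite -[k]addn0; apply: fps_val_geM. Qed.

Lemma fps_val_geX k : fps_val_ge k (fpsX ^+ k).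
Proof.
elim: k => [//|k IH]; rewrite exprS -add1n.
by apply: fps_val_geM => // -[].
Qed.

Lemma fps_unit1 f : fcoef f 0 = 1 -> f \is a GRing.unit.
Proof.
move=> f01; pose h := 1 - f; pose S n := \sum_(k < n.+1) h ^+ k.
have h0 : fps_val_ge 1 h.
  by case=> [|//] _; rewrite fcoefD fcoefN fcoef1 f01 subrr.
have hk k : fps_val_ge k (h ^+ k).
  elim: k => [//|k IH]; rewrite exprS -add1n; exact: fps_val_geM.
have Sstab n i : (i <= n)%N -> fcoef (S i) i = fcoef (S n) i.
  move=> le_in; rewrite /S !fcoef_sum
    (big_ord_widen n.+1 (fun k => fcoef (h ^+ k) i)) ?ltnS //.
  rewrite [RHS](bigID (fun k : 'I_n.+1 => (k < i.+1)%N)) /=.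
  by rewrite [X in _ = _ + X]big1 ?addr0 // => k; rewrite -leqNgt => /hk ->.
pose g : fps A := Fps (fun n => fcoef (S n) n).
suff gf : g * f = 1 by apply: (fps_unitP gf).
apply: fpsP => n; transitivity (fcoef (S n * f) n).
  rewrite !fcoefM; apply: eq_bigr => i _; congr (_ * _).
  by rewrite -Sstab // -ltnS.
have -> : S n * f = 1 - h ^+ n.+1.
  by rewrite -[RHS]opprB subrX1 -mulNr opprB subKr mulrC.
by rewrite fcoefD fcoefN hk // oppr0 addr0.
Qed.

End FpsRing.

Arguments fpsC {A} c.
Arguments fpsX {A}.
Arguments fcoef {A} f n : simpl never.

Section QSeries.
Variable A : comNzRingType.

(* The q-adic limit: the n-th coefficient is the value at which the n-th
   coefficients of the u k stabilise (0 if they do not stabilise). *)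
Definition fps_lim (u : nat -> fps A) : fps A :=
  Fps (fun n => xget 0
    [set c | exists N, forall k, (N <= k)%N -> fcoef (u k) n = c]%classic).

Lemma fps_limE (u : nat -> fps A) n N c :
  (forall k, (N <= k)%N -> fcoef (u k) n = c) -> fcoef (fps_lim u) n = c.
Proof.
move=> uc; rewrite /fcoef /=; case: xgetP => [d _ [M ud]|/(_ c)]; last by case; exists N.
by rewrite -(ud _ (leq_maxl M N)) uc // leq_maxr.
Qed.

Definition fps_series (m : nat) (u : nat -> fps A) : fps A :=
  fps_lim (fun N => \sum_(m <= k < N) u k).

Lemma fps_seriesE m (u : nat -> fps A) n :
  (forall k, fps_val_ge k (u k)) ->
  fcoef (fps_series m u) n = fcoef (\sum_(m <= k < n.+1) u k) n.
Proof.
move=> uk; apply: (@fps_limE _ _ (maxn m n.+1)) => N.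
rewrite geq_max => /andP[mN nN]; rewrite !fcoef_sum.
rewrite [LHS](big_nat_widenl _ 0%N) // [RHS](big_nat_widenl _ 0%N) //.
rewrite (big_cat_nat (leq0n n.+1) nN) /= [X in _ + X]big1_seq ?addr0 //.
by move=> k /andP[_]; rewrite mem_index_iota => /andP[nk _]; apply: uk.
Qed.

End QSeries.

Definition qpoch (S : nzRingType) (a q : S) (n : nat) : S :=
  \prod_(0 <= j < n) (1 - a * q ^+ j).

Definition qpoch_inf (A : comNzRingType) (a q : fps A) : fps A :=
  fps_lim (qpoch a q).

Lemma qpoch_infE (A : comNzRingType) (a q : fps A) n :
  fps_val_ge 1 q -> fcoef (qpoch_inf a q) n = fcoef (qpoch a q n.+1) n.
Proof.
move=> q1; apply: (@fps_limE _ _ _ n.+1) => k; elim: k => // k IH.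
rewrite leq_eqVlt => /predU1P[-> //|]; rewrite ltnS => nk.
rewrite -IH // /qpoch big_nat_recr //= mulrBr mulr1 fcoefD fcoefN.
suff /(_ n nk) -> : fps_val_ge k
    ((\prod_(0 <= i < k) (1 - a * q ^+ i)) * (a * q ^+ k)).
  by rewrite oppr0 addr0.
rewrite mulrA mulrC; apply: fps_val_geMl.
elim: (k) => [//|j IHj]; rewrite exprS -add1n; exact: fps_val_geM.
Qed.

Lemma qpoch_coef0 (A : comNzRingType) (a q : fps A) n :
  fps_val_ge 1 a -> fcoef (qpoch a q n) 0 = 1.
Proof.
move=> a1; elim: n => [|n IH]; first by rewrite /qpoch big_geq // fcoef1.
rewrite /qpoch big_nat_recr //= fcoefM big_ord1 -/(qpoch a q n) IH mul1r.
by rewrite fcoefD fcoefN fcoef1 (fps_val_geMl _ a1) // subr0.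
Qed.

Section Compositions.
Variable R : comNzRingType.

Local Notation q := (fpsX : fps (laurent R)).
Local Notation z := (fpsC (zpow R 1)).
Local Notation z' := (fpsC (zpow R (-1))).

Definition VO_term (n : nat) : fps (laurent R) :=
  q ^+ (2 * n - 1) / (qpoch_inf (z * q ^+ (2 * n + 1)) (q ^+ 2) *
                      qpoch_inf (z' * q ^+ (2 * n + 1)) (q ^+ 2)).

Definition XO_term (n : nat) : fps (laurent R) :=
  q ^+ (2 * n + 1) / (qpoch (z * q) (q ^+ 2) n * qpoch (z' * q) (q ^+ 2) n).

Definition VOgf : fps (laurent R) := fps_series 1 VO_term.
Definition XOgf : fps (laurent R) := fps_series 0 XO_term.

Definition VO (m : int) (n : nat) : R := (fcoef VOgf n)@_m.
Definition XO (m : int) (n : nat) : R := (fcoef XOgf n)@_m.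

(* The inverses and limits above are genuine: the denominators are units and
   the partial sums stabilise coefficientwise. *)
Lemma VO_denom_unit n :
  qpoch_inf (z * q ^+ (2 * n + 1)) (q ^+ 2) *
  qpoch_inf (z' * q ^+ (2 * n + 1)) (q ^+ 2) \is a GRing.unit.
Proof.
have q2 : fps_val_ge 1 (q ^+ 2) by move=> k k1; apply: (@fps_val_geX _ 2); apply: leqW.
rewrite unitrM; apply/andP; split; apply: fps_unit1;
  rewrite qpoch_infE // qpoch_coef0 // => k k0;
  rewrite mulrC (fps_val_geMl _ (@fps_val_geX _ _)) //;
  by rewrite (leq_trans k0) // addn1.
Qed.

Lemma XO_denom_unit n :
  qpoch (z * q) (q ^+ 2) n * qpoch (z' * q) (q ^+ 2) n \is a GRing.unit.
Proof.
rewrite unitrM; apply/andP; split; apply: fps_unit1;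
  rewrite qpoch_coef0 // mulrC -[q]expr1; apply: fps_val_geMl;
  exact: fps_val_geX.
Qed.

Lemma fcoef_VOgf n :
  fcoef VOgf n = fcoef (\sum_(1 <= k < n.+1) VO_term k) n.
Proof.
apply: fps_seriesE => k; apply: fps_val_geMl => i ik; apply: fps_val_geX.
by case: k ik => // k ik; rewrite (leq_trans ik) // mul2n -addnn addnS subn1 leq_addr.
Qed.

Lemma fcoef_XOgf n :
  fcoef XOgf n = fcoef (\sum_(0 <= k < n.+1) XO_term k) n.
Proof.
apply: fps_seriesE => k; apply: fps_val_geMl => i ik; apply: fps_val_geX.
by rewrite (leq_trans ik) // addn1 leqW // leq_pmull.
Qed.

End Compositions.

Section Unimodal.
Variable R : realType.

Definition in_U2z (c : laurent R) : Prop :=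
  [/\ forall i : int, 0 <= c@_i,
      forall i : int, c@_(- i) = c@_i &
      forall r l : nat, (r < 2)%N ->
        c@_((r + 2 * l.+1)%N%:Z) <= c@_((r + 2 * l)%N%:Z)].

Definition in_U2zq (C : fps (laurent R)) : Prop :=
  forall n, in_U2z (fcoef C n).

End Unimodal.

(* Main.v *)
(* Let chi_k = z^k + z^(k-2) + ... + z^(-k).  Multiplication by chi_k preserves
   U_z^2: the coefficients of c * chi_k at m and m + 2 are sums of k + 1
   coefficients of c which share all but one term, so they differ by
   c_{m-k} - c_{m+k+2} >= 0.  As 1/((1 - z x)(1 - z^{-1} x)) is the sum of the
   chi_k x^k, U_{z,q}^2 is stable under division by such a factor with x a
   positive power of q, hence under division by the denominators of the terms of
   both generating functions. *)
Require Import Defs.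
From mathcomp Require Import all_boot all_order all_algebra.
From mathcomp Require Import reals monalg zify ring.

Set Implicit Arguments.
Unset Strict Implicit.
Unset Printing Implicit Defensive.

Import Order.TTheory GRing.Theory Num.Theory.
Local Open Scope ring_scope.

Section FormalPowerSeries.
Variable A : comNzRingType.
Implicit Types f g : fps A.

Lemma fcoef_mulC f (c : A) n : fcoef (f * fpsC c) n = fcoef f n * c.
Proof.
rewrite fcoefM big_ord_recr /= subnn big1 ?add0r // => i _.
by rewrite /fcoef /= ifF ?mulr0 //; have := ltn_ord i; lia.
Qed.

Lemma fcoef_mulX f n : fcoef (f * fpsX) n = if n is m.+1 then fcoef f m else 0.
Proof.
case: n => [|n]; first by rewrite fcoefM big_ord1 /= [fcoef fpsX _]/fcoef mulr0.
rewrite fcoefM !big_ord_recr /= subnn subSnn !/(fcoef fpsX _) /= mulr0 mulr1 addr0.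
rewrite big1 ?add0r // => i _; rewrite /fcoef /=.
by rewrite (_ : (_ == 1)%N = false) ?mulr0 //; have := ltn_ord i; lia.
Qed.

Lemma fpsCD (a b : A) : fpsC (a + b) = fpsC a + fpsC b.
Proof. by apply: fpsP => -[|n]; rewrite /fcoef /= ?addr0. Qed.

Lemma fpsCN (a : A) : fpsC (- a) = - fpsC a.
Proof. by apply: fpsP => -[|n]; rewrite /fcoef /= ?oppr0. Qed.

Lemma fpsCM (a b : A) : fpsC (a * b) = fpsC a * fpsC b.
Proof.
by apply: fpsP => -[|n]; rewrite fcoef_mulC /fcoef /= ?mul0r.
Qed.

Lemma fps_val_geMr k f g : fps_val_ge k g -> fps_val_ge k (f * g).
Proof. by rewrite mulrC; apply: fps_val_geMl. Qed.

Lemma fps_val_geB k f g : fps_val_ge k f -> fps_val_ge k g -> fps_val_ge k (f - g).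
Proof. by move=> fk gk n nk; rewrite fcoefD fcoefN fk // gk // subrr. Qed.

Lemma fps_val_geW j k f : (j <= k)%N -> fps_val_ge k f -> fps_val_ge j f.
Proof. by move=> jk fk n nj; apply: fk; apply: leq_trans jk. Qed.

Lemma fps_val_ge_expr k f : fps_val_ge 1 f -> fps_val_ge k (f ^+ k).
Proof.
move=> f1; elim: k => [//|k IH].
by rewrite exprS -add1n; apply: fps_val_geM.
Qed.

Lemma unit_subr_val1 f : fps_val_ge 1 f -> 1 - f \is a GRing.unit.
Proof. by move=> f1; apply: fps_unit1; rewrite fcoefD fcoefN fcoef1 f1 // subr0. Qed.

Lemma qpoch_unit f g n : fps_val_ge 1 f -> qpoch f g n \is a GRing.unit.
Proof. by move=> f1; apply: fps_unit1; exact: qpoch_coef0. Qed.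

Lemma qpoch_inf_trunc f g k :
  fps_val_ge 1 g -> fps_val_ge k (qpoch_inf f g - qpoch f g k).
Proof.
move=> g1 n nk; rewrite fcoefD fcoefN qpoch_infE //; apply/eqP; rewrite subr_eq0.
apply/eqP; elim: k nk => // k IH.
rewrite leq_eqVlt => /predU1P[-> //|]; rewrite ltnS => nk.
rewrite IH // /qpoch [in RHS]big_nat_recr //= mulrBr mulr1 fcoefD fcoefN.
rewrite [X in _ - X](_ : _ = 0) ?subr0 //; move: nk.
by apply/fps_val_geMr/fps_val_geMr/fps_val_ge_expr.
Qed.

Lemma fps_val_geV k f g : f \is a GRing.unit -> g \is a GRing.unit ->
  fps_val_ge k (f - g) -> fps_val_ge k (f^-1 - g^-1).
Proof.
move=> fu gu fg; have -> : f^-1 - g^-1 = - (f^-1 * g^-1) * (f - g).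
  by rewrite mulNr mulrBr mulrAC mulVr // mul1r -mulrA mulVr // mulr1 opprB.
exact: fps_val_geMr.
Qed.

Lemma val_ge1_mulXn f b : (0 < b)%N -> fps_val_ge 1 (f * fpsX ^+ b).
Proof. by move=> b0; apply/fps_val_geMr/(fps_val_geW b0)/fps_val_geX. Qed.

Lemma div_qpoch0 f a b g : f / (qpoch a g 0 * qpoch b g 0) = f.
Proof. by rewrite /qpoch !big_geq // mulr1 divr1. Qed.

Lemma div_qpochS f a b k m n : (0 < m)%N ->
  f / (qpoch (a * fpsX ^+ m) (fpsX ^+ k) n.+1 *
       qpoch (b * fpsX ^+ m) (fpsX ^+ k) n.+1) =
  f / (qpoch (a * fpsX ^+ m) (fpsX ^+ k) n *
       qpoch (b * fpsX ^+ m) (fpsX ^+ k) n) /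
    ((1 - a * fpsX ^+ (m + k * n)) * (1 - b * fpsX ^+ (m + k * n))).
Proof.
move=> m0; have qS (c : fps A) : qpoch (c * fpsX ^+ m) (fpsX ^+ k) n.+1 =
    qpoch (c * fpsX ^+ m) (fpsX ^+ k) n * (1 - c * fpsX ^+ (m + k * n)).
  by rewrite /qpoch big_nat_recr //= -mulrA -exprM -exprD.
have mn0 : (0 < m + k * n)%N by rewrite addn_gt0 m0.
rewrite !qS mulrACA invrM; first by rewrite [X in f * X]mulrC mulrA.
  by rewrite unitrM !qpoch_unit //; apply: val_ge1_mulXn.
by rewrite unitrM !unit_subr_val1 //; apply: val_ge1_mulXn.
Qed.

Lemma fcoef_div_qpoch_inf f a b k m n : (0 < m)%N -> (0 < k)%N ->
  fcoef (f / (qpoch_inf (a * fpsX ^+ m) (fpsX ^+ k) *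
              qpoch_inf (b * fpsX ^+ m) (fpsX ^+ k))) n =
  fcoef (f / (qpoch (a * fpsX ^+ m) (fpsX ^+ k) n.+1 *
              qpoch (b * fpsX ^+ m) (fpsX ^+ k) n.+1)) n.
Proof.
move=> m0 k0; have qk1 : fps_val_ge 1 (fpsX ^+ k : fps A).
  exact/(fps_val_geW k0)/fps_val_geX.
have infu (c : fps A) : qpoch_inf (c * fpsX ^+ m) (fpsX ^+ k) \is a GRing.unit.
  by apply: fps_unit1; rewrite qpoch_infE // qpoch_coef0 //; apply: val_ge1_mulXn.
have := qpoch_inf_trunc (k := n.+1) (b * fpsX ^+ m) qk1.
have := qpoch_inf_trunc (k := n.+1) (a * fpsX ^+ m) qk1.
set P := qpoch_inf _ _; set Q := qpoch _ _ _.
set P' := qpoch_inf _ _; set Q' := qpoch _ _ _ => PQ PQ'.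
suff dPQ : fps_val_ge n.+1 ((P * P')^-1 - (Q * Q')^-1).
  rewrite -[in LHS](subrK (Q * Q')^-1 (P * P')^-1) mulrDr fcoefD.
  by rewrite (fps_val_geMr _ dPQ) // add0r.
apply: fps_val_geV; first by rewrite unitrM !infu.
  by rewrite unitrM !qpoch_unit //; apply: val_ge1_mulXn.
have -> : P * P' - Q * Q' = (P - Q) * P' - - Q * (P' - Q') by ring.
by apply: fps_val_geB; [apply: fps_val_geMl | apply: fps_val_geMr].
Qed.

Lemma fcoef_divE n f d g e : d * g = 1 - e -> d \is a GRing.unit ->
  fps_val_ge n.+1 e -> fcoef (f / d) n = fcoef (f * g) n.
Proof.
move=> dg du en; have -> : f / d = f * g + f / d * e.
  by rewrite -[e](subKr 1) -dg mulrBr mulr1 mulrA (mulrVK du) addrC subrK.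
by rewrite fcoefD (fps_val_geMr _ en) // addr0.
Qed.

End FormalPowerSeries.

Section LaurentCoefficients.
Variable R : comNzRingType.
Implicit Types c : laurent R.

Local Notation z := (fpsC (zpow R 1)).
Local Notation z' := (fpsC (zpow R (-1))).

Lemma mcoeff_mul_zpow c (j m : int) : (c * zpow R j)@_m = c@_(m - j).
Proof.
have -> : c * zpow R j = lmul (zpow R j) c by exact: mulrC.
rewrite /zpow lmulUg raddf_sum /= [in RHS](monalgE c) raddf_sum /=.
apply: eq_bigr => i _; rewrite !mcoeffU mul1r.
by rewrite (can2_eq (addKr j) (addNKr j)) [- j + m]addrC.
Qed.

Definition chi (k : nat) : laurent R :=
  \sum_(i < k.+1) zpow R (k%:Z - (2 * i)%N%:Z).

Lemma chi0 : chi 0 = 1.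
Proof. by rewrite /chi big_ord1. Qed.

Lemma chi_recl k : chi k.+1 = zpow R k.+1%:Z + zpow R (-1) * chi k.
Proof.
rewrite /chi big_ord_recl /= muln0 subr0 mulr_sumr; congr (_ + _).
by apply: eq_bigr => i _; rewrite -zpowD /bump /=; congr zpow; lia.
Qed.

Lemma chi_recr k : chi k.+1 = zpow R 1 * chi k + zpow R (- k.+1%:Z).
Proof.
rewrite /chi big_ord_recr /= mulr_sumr; congr (_ + _).
  by apply: eq_bigr => i _; rewrite -zpowD; congr zpow; lia.
by congr zpow; lia.
Qed.

Lemma chi1 : chi 1 = zpow R 1 + zpow R (-1).
Proof. by rewrite chi_recl chi0 mulr1. Qed.

Lemma chiSS k : chi k.+2 = (zpow R 1 + zpow R (-1)) * chi k.+1 - chi k.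
Proof.
rewrite chi_recr mulrDl -addrA; congr (_ + _).
rewrite chi_recr mulrDr mulrA -!zpowD addNr zpow0 mul1r addrC addrA addNr add0r.
by congr zpow; lia.
Qed.

Lemma mcoeff_mul_chi c k m :
  (c * chi k)@_m = \sum_(i < k.+1) c@_(m - k%:Z + (2 * i)%N%:Z).
Proof.
rewrite /chi mulr_sumr raddf_sum /=; apply: eq_bigr => i _.
by rewrite mcoeff_mul_zpow opprB addrCA addrC.
Qed.

Lemma chi_series (x : fps (laurent R)) N :
  (1 - z * x) * (1 - z' * x) * \sum_(k < N.+1) fpsC (chi k) * x ^+ k
  = 1 - (fpsC (chi N.+1) - fpsC (chi N) * x) * x ^+ N.+1.
Proof.
have zz : z * z' = 1 by rewrite -fpsCM -zpowD zpow0.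
elim: N => [|N IH].
  by rewrite big_ord1 chi0 chi1 fpsCD (_ : fpsC 1 = 1) //; ring: zz.
rewrite big_ord_recr mulrDr IH chiSS fpsCD fpsCN fpsCM fpsCD.
rewrite [x ^+ N.+2]exprS; ring: zz.
Qed.

End LaurentCoefficients.

Arguments chi {R} k.

Section Unimodality.
Variable R : realType.

Local Notation q := (fpsX : fps (laurent R)).
Local Notation z := (fpsC (zpow R 1)).
Local Notation z' := (fpsC (zpow R (-1))).

Implicit Types (c d : laurent R) (f g : fps (laurent R)).

Lemma in_U2z_coef_le c (i j : int) l :
  in_U2z c -> j = i + (2 * l)%N%:Z -> 0 <= i + j -> c@_j <= c@_i.
Proof.
case=> _ csym cdec.
have step n : c@_(n + 2)%N%:Z <= c@_n%:Z.
  have := cdec _ n./2 (ltn_mod n 2).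
  have -> : (n %% 2 + 2 * n./2 = n)%N by lia.
  by have -> : (n %% 2 + 2 * n./2.+1 = n + 2)%N by lia.
have steps n k : c@_(n + 2 * k)%N%:Z <= c@_n%:Z.
  elim: k => [|k IH]; first by rewrite muln0 addn0.
  by apply: le_trans IH; rewrite mulnS [(2 + _)%N]addnC addnA.
move=> jE ij.
have jn : j = `|j|%N%:Z by lia.
have [i0|i0] := lerP 0 i.
  have iE : i = `|i|%N%:Z by lia.
  have lE : `|j|%N = (`|i| + 2 * l)%N by lia.
  by rewrite jn iE lE.
have iE : - i = `|i|%N%:Z by lia.
have lE : `|j|%N = (`|i| + 2 * `|(l%:Z + i)%R|)%N by lia.
by rewrite -[c@_i]csym iE jn lE.
Qed.

Lemma in_U2z0 : in_U2z (0 : laurent R).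
Proof. by split=> *; rewrite !mcoeff0. Qed.

Lemma in_U2zD c d : in_U2z c -> in_U2z d -> in_U2z (c + d).
Proof.
move=> [c0 cs cd] [d0 ds dd]; split=> [i|i|r l r2]; rewrite !mcoeffD.
- by rewrite addr_ge0.
- by rewrite cs ds.
- by rewrite lerD ?cd ?dd.
Qed.

Lemma in_U2z_sum (I : Type) (s : seq I) (P : pred I) (F : I -> laurent R) :
  (forall i, P i -> in_U2z (F i)) -> in_U2z (\sum_(i <- s | P i) F i).
Proof. by move=> UF; elim/big_ind: _ => //; [exact: in_U2z0 | exact: in_U2zD]. Qed.

Lemma in_U2z1 : in_U2z (1 : laurent R).
Proof.
have c1 (i : int) : (1 : laurent R)@_i = (i == 0)%:R.
  by rewrite -zpow0 /zpow mcoeffU eq_sym.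
split=> [i|i|r l r2]; rewrite !c1 ?ler0n ?oppr_eq0 //.
by rewrite ler_nat; lia.
Qed.

Lemma in_U2z_mul_chi c k : in_U2z c -> in_U2z (c * chi k).
Proof.
move=> cU; have [c0 cs _] := cU; split=> [i|i|r l r2]; rewrite !mcoeff_mul_chi.
- by apply: sumr_ge0.
- rewrite (reindex_inj rev_ord_inj) /=; apply: eq_bigr => j _.
  by rewrite -cs; congr (_ @_ _); have := ltn_ord j; lia.
- rewrite big_ord_recr [leRHS]big_ord_recl /= addrC lerD //.
    by apply: (@in_U2z_coef_le _ _ _ k.+1) => //; lia.
  apply: ler_sum => j _; rewrite /bump /=.
  by rewrite (_ : (r + 2 * l.+1)%N%:Z - k%:Z + (2 * j)%N%:Z =
      (r + 2 * l)%N%:Z - k%:Z + (2 * (1 + j))%N%:Z) //; lia.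
Qed.

Lemma in_U2zq1 : in_U2zq (1 : fps (laurent R)).
Proof. by case=> [|n]; rewrite fcoef1; [exact: in_U2z1 | exact: in_U2z0]. Qed.

Lemma in_U2zq_sum (I : Type) (s : seq I) (P : pred I) (F : I -> fps (laurent R)) :
  (forall i, P i -> in_U2zq (F i)) -> in_U2zq (\sum_(i <- s | P i) F i).
Proof. by move=> UF n; rewrite fcoef_sum; apply: in_U2z_sum => i /UF. Qed.

Lemma in_U2zq_mulXn f k : in_U2zq f -> in_U2zq (f * fpsX ^+ k).
Proof.
move=> fU; elim: k => [|k IH]; first by rewrite mulr1.
by rewrite exprSr mulrA => -[|n]; rewrite fcoef_mulX; [exact: in_U2z0 | exact: IH].
Qed.

Lemma in_U2zq_mul_chi f k : in_U2zq f -> in_U2zq (f * fpsC (chi k)).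
Proof. by move=> fU n; rewrite fcoef_mulC; apply: in_U2z_mul_chi. Qed.

Lemma in_U2zq_div_factor f a : (0 < a)%N -> in_U2zq f ->
  in_U2zq (f / ((1 - z * q ^+ a) * (1 - z' * q ^+ a))).
Proof.
move=> a0 fU n; have q1 : fps_val_ge 1 (q ^+ a : fps (laurent R)).
  exact: fps_val_geW a0 (@fps_val_geX _ _).
rewrite (fcoef_divE _ (chi_series _ n)); last 2 first.
- by rewrite unitrM; apply/andP; split; apply/unit_subr_val1/fps_val_geMr/q1.
- exact/fps_val_geMr/fps_val_ge_expr.
rewrite mulr_sumr; apply: in_U2zq_sum => k _.
by rewrite mulrA -exprM; apply: in_U2zq_mulXn; apply: in_U2zq_mul_chi.
Qed.

Lemma in_U2zq_div_qpoch f b k : (0 < b)%N -> in_U2zq f ->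
  in_U2zq (f / (qpoch (z * q ^+ b) (q ^+ 2) k * qpoch (z' * q ^+ b) (q ^+ 2) k)).
Proof.
move=> b0 fU; elim: k => [|k IH]; first by rewrite div_qpoch0.
rewrite (div_qpochS _ _ _ _ _ b0); apply: in_U2zq_div_factor IH.
by rewrite addn_gt0 b0.
Qed.

Lemma in_U2zq_div_qpoch_inf f b : (0 < b)%N -> in_U2zq f ->
  in_U2zq (f / (qpoch_inf (z * q ^+ b) (q ^+ 2) * qpoch_inf (z' * q ^+ b) (q ^+ 2))).
Proof.
move=> b0 fU n; rewrite (fcoef_div_qpoch_inf _ _ _ _ b0) //.
exact: in_U2zq_div_qpoch.
Qed.

Lemma in_U2zq_VOgf : in_U2zq (VOgf R).
Proof.
move=> n; rewrite fcoef_VOgf.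
apply: in_U2zq_sum => k _; apply: in_U2zq_div_qpoch_inf; first by rewrite addn1.
by rewrite -[_ ^+ _]mul1r; apply/in_U2zq_mulXn/in_U2zq1.
Qed.

Lemma in_U2zq_XOgf : in_U2zq (XOgf R).
Proof.
move=> n; rewrite fcoef_XOgf.
apply: in_U2zq_sum => k _; apply: (@in_U2zq_div_qpoch _ 1) => //.
by rewrite -[_ ^+ _]mul1r; apply/in_U2zq_mulXn/in_U2zq1.
Qed.

End Unimodality.

Theorem theorem4p8 (R : realType) :
  [/\ in_U2zq (VOgf R),
      in_U2zq (XOgf R),
      forall m n : nat, VO R (m + 2)%N%:Z n <= VO R m%:Z n &
      forall m n : nat, XO R (m + 2)%N%:Z n <= XO R m%:Z n].
Proof.
split=> [||m n|m n]; [exact: in_U2zq_VOgf | exact: in_U2zq_XOgf | |].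
  by apply: (in_U2z_coef_le (l := 1) (@in_U2zq_VOgf R n)); lia.
by apply: (in_U2z_coef_le (l := 1) (@in_U2zq_XOgf R n)); lia.
Qed.
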